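(* For $p>0$ and $x\in(0,\pi/2)$ let $$\varphi_{p,1}(x) = \frac{\sin x}{x} - \frac{2}{\pi} - p(\pi - 2x).$$ Let $p_1 = \frac{\pi-2}{\pi^2} = 0.11566\ldots$ and $p_2 = \frac{2}{\pi^2} = 0.20264\ldots$. Then: (i) If $p \in (0, p_1]$, then for all $x\in(0,\pi/2)$ $$\frac{\sin x}{x} > \frac{2}{\pi} + p_1(\pi-2x) \geq \frac{2}{\pi} + p(\pi-2x).$$ (ii) If $p \in (p_1,p_2)$, then the equation $\varphi_{p,1}(x)=0$ has a unique solution $x_0^{(p)}$ in $(0,\pi/2)$, and $$x \in \left(0,x_0^{(p)}\right) \Longrightarrow \frac{\sin x}{x} < \frac{2}{\pi} + p(\pi-2x), \qquad x\in\left(x_0^{(p)},\frac{\pi}{2}\right) \Longrightarrow \frac{\sin x}{x} > \frac{2}{\pi}+p(\pi-2x).$$ (iii) If $p\in[p_2,+\infty)$, then for all $x\in(0,\pi/2)$ $$\frac{\sin x}{x} < \frac{2}{\pi} + p_2(\pi-2x) \leq \frac{2}{\pi}+p(\pi-2x).$$ (iv) For each $p\in(p_1,p_2]$, the function $\varphi_{p,1}$ has exactly one maximum on $(0,\pi/2)$, at a point $m^{(p)}\in(0,\pi/2)$. (v) The equation $\left|\varphi_{p,1}(0+)\right| = \left|\varphi_{p,1}\left(m^{(p)}\right)\right|$ has, for the parameter $p\in(p_1,p_2)$, the solution $p=p_0$, numerically determined as $p_0 = 0.13323\ldots$. For the value $$d_0 = \left|\varphi_{p_0,1}(0+)\right|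 = \left|\varphi_{p_0,1}\left(m^{(p_0)}\right)\right| = 0.055187\ldots$$ it holds $$d_0 = \inf_{p\in(0,\infty)}\ \sup_{x\in(0,\pi/2)} \left|\varphi_{p,1}(x)\right|.$$ Hence the minimax approximant of the family $\varphi_{p,1}$ ($p>0$) is $\varphi_{p_0,1}(x) = \frac{\sin x}{x}-\frac{2}{\pi}-p_0(\pi-2x)$, which determines the corresponding minimax approximation $\frac{\sin x}{x}\approx \frac{2}{\pi}+p_0(\pi-2x)$.
   Context: ''Maximum'' on the open interval $(0,\pi/2)$ in (iv) means local maximum at an interior point. The notation $f(0+)$ means $\lim_{x\to 0+} f(x)$. Minimax approximant: for a family of functions $\varphi_p(x)$, $x \in (a,b)$, $p \in \mathbb{R}^+ = (0,\infty)$, if the infimum over $p$ of the error $d(p) = \sup_{x\in(a,b)}|\varphi_p(x)|$ is attained at $p = p_0 \in \mathbb{R}^+$, then $\varphi_{p_0}$ is called the minimax approximant of the family on $(a,b)$. A decimal followed by ''$\ldots$'' gives the leading digits of the decimal expansion.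
   Formalization: Part (iv) is stated for p in (p_1,p_2) instead of (p_1,p_2]: at p = p_2 the derivative (sin x/x)' + 4/π² is positive on (0,π/2), so φ_{p_2,1} is strictly increasing and has no interior maximum. *)

(* Defs.v *)
From Stdlib Require Import Reals.
From Coquelicot Require Import Coquelicot.
Open Scope R_scope.

Definition phi1 (p x : R) : R := sin x / x - 2 / PI - p * (PI - 2 * x).

Definition p1 : R := (PI - 2) / PI ^ 2.
Definition p2 : R := 2 / PI ^ 2.

(* f(a+) = l *)
Definition is_right_limit (f : R -> R) (a l : R) : Prop :=
  filterlim f (at_right a) (locally l).

(* Two-sided neighbourhood, so this is a maximum at an interior point.
   For [phi1 p] on (0, PI/2), such a point exists only when p < p2: the
   derivative of sin x / x decreases strictly from 0 at 0+ to - 2 * p2 at PI/2,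
   so [phi1 p2] is strictly increasing on (0, PI/2). *)
Definition is_local_max (f : R -> R) (x : R) : Prop :=
  locally x (fun y => f y <= f x).

Definition sup_abs (f : R -> R) (a b : R) : Rbar :=
  Lub_Rbar (fun y => exists x, a < x < b /\ y = Rabs (f x)).

(* Infimum over p > 0 of [sup_abs (phi p) a b]. Only the finite suprema are
   listed: the value p_infty does not affect an infimum, and if every supremum
   is infinite the set is empty and its infimum is p_infty. *)
Definition minimax_error (phi : R -> R -> R) (a b : R) : Rbar :=
  Glb_Rbar (fun y => exists p, 0 < p /\ sup_abs (phi p) a b = Finite y).

Definition is_minimax_parameter (phi : R -> R -> R) (a b p : R) : Prop :=
  0 < p /\ sup_abs (phi p) a b = minimax_error phi a b.

(* Main.v *)
Require Import Defs.
From Stdlib Require Import Reals Ranalysis5 Lra ClassicalEpsilon.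
From Coquelicot Require Import Coquelicot.
Open Scope R_scope.

(** Everything rests on the strict concavity of [sin x / x], extended by 1 at 0,
    on the closed interval from 0 to [PI / 2]. The numerator of its second
    derivative has derivative [- x ^ 2 * cos x], so the first derivative decreases
    strictly, from 0 at 0 to [- 2 * p2] at [PI / 2], and the graph lies strictly
    below each of its tangents ([sinc_below_tangent]). Subtracting an affine
    function preserves this, so each member [phi1 p] of the family, extended to
    the closed interval as [phi_ext p], is strictly concave. It vanishes at
    [PI / 2] and equals [PI * (p1 - p)] at 0.

    For [p = p1] both end values are 0 and the function is positive between them;
    for [p = p2] the subtracted line is the tangent at [PI / 2] and the function
    is negative. For [p] strictly between, the end value at 0 is negative and the
    derivative vanishes at exactly one interior point [m], which is the maximum;
    the maximal value is positive. A concave function that is negative at 0, is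
    positive somewhere, and vanishes at [PI / 2] changes sign exactly once before
    [PI / 2] ([phi_ext_zero_exists]).

    The error of [phi1 p] is therefore the larger of [PI * (p - p1)], its modulus
    at 0, and its maximum. The former increases with [p] and the latter decreases,
    so the minimax parameter is the one at which they agree: a smaller parameter
    gives a larger value at the old critical point, a larger parameter gives a
    larger error near 0 ([exceeds_balanced]). To locate this parameter, [p] is
    written as minus half the derivative at the critical point [x]; equality
    becomes one equation [balance x = 0] in [x]. The sign of [balance] at two
    rational points at distance 0.0000006 isolates a root, and the
    monotonicity of the derivative turns these points into bounds on the
    parameter and on the error ([balanced_parameter_exists]). *)

(** * Rational bounds on pi, sine and cosine *)

(* Factorials are expanded in R: as unary naturals they would be far too large. *)
Ltac expand_partial_sum :=
  unfold cos_approx, sin_approx, cos_term, sin_term;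
  cbn [Nat.mul Nat.add sum_f_R0];
  rewrite ?fact_simpl, ?mult_INR;
  change (Factorial.fact 0) with 1%nat;
  rewrite ?INR_IZR_INZ; cbn [Z.of_nat Pos.of_succ_nat Pos.succ].

(** The cosine is positive at the lower rational and negative at the upper
    one, so its zero [PI / 2] lies between them. *)
Lemma PI_bounds : 3.1415926534 < PI < 3.1415926536.
Proof.
  split.
  - assert (0 < cos 1.5707963267).
    { eapply Rlt_le_trans; [| apply (pre_cos_bound _ 5); lra].
      expand_partial_sum. lra. }
    apply Rnot_le_lt. intro. pose proof PI2_1.
    assert (cos 1.5707963267 <= 0); [| lra].
    apply cos_le_0; lra.
  - assert (cos 1.5707963268 < 0).
    { eapply Rle_lt_trans; [apply (pre_cos_bound _ 5); lra |].
      expand_partial_sum. lra. }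
    apply Rnot_le_lt. intro. pose proof PI_RGT_0.
    assert (0 <= cos 1.5707963268); [| lra].
    apply cos_ge_0; lra.
Qed.

Lemma inv_PI_bounds : 0.31830988616 < / PI < 0.31830988621.
Proof.
  pose proof PI_bounds. split.
  - apply Rmult_lt_reg_r with PI; [lra |]. rewrite Rinv_l; lra.
  - apply Rmult_lt_reg_r with PI; [lra |]. rewrite Rinv_l; lra.
Qed.

Lemma sin_86172_bounds : 0.75896363378 < sin 0.86172 < 0.75896363379.
Proof.
  assert (0 <= 0.86172) as H1 by lra. assert (0.86172 <= 4) as H2 by lra.
  destruct (pre_sin_bound 0.86172 3 H1 H2) as [Hl Hu]. split.
  - eapply Rlt_le_trans; [| exact Hl]. expand_partial_sum. lra.
  - eapply Rle_lt_trans; [exact Hu |]. expand_partial_sum. lra.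
Qed.

Lemma cos_86172_bounds : 0.65113301451 < cos 0.86172 < 0.65113301452.
Proof.
  assert (-2 <= 0.86172) as H1 by lra. assert (0.86172 <= 2) as H2 by lra.
  destruct (pre_cos_bound 0.86172 3 H1 H2) as [Hl Hu]. split.
  - eapply Rlt_le_trans; [| exact Hl]. expand_partial_sum. lra.
  - eapply Rle_lt_trans; [exact Hu |]. expand_partial_sum. lra.
Qed.

Lemma sin_8617206_bounds : 0.75896402446 < sin 0.8617206 < 0.75896402447.
Proof.
  assert (0 <= 0.8617206) as H1 by lra. assert (0.8617206 <= 4) as H2 by lra.
  destruct (pre_sin_bound 0.8617206 3 H1 H2) as [Hl Hu]. split.
  - eapply Rlt_le_trans; [| exact Hl]. expand_partial_sum. lra.
  - eapply Rle_lt_trans; [exact Hu |]. expand_partial_sum. lra.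
Qed.

Lemma cos_8617206_bounds : 0.65113255913 < cos 0.8617206 < 0.65113255914.
Proof.
  assert (-2 <= 0.8617206) as H1 by lra. assert (0.8617206 <= 2) as H2 by lra.
  destruct (pre_cos_bound 0.8617206 3 H1 H2) as [Hl Hu]. split.
  - eapply Rlt_le_trans; [| exact Hl]. expand_partial_sum. lra.
  - eapply Rle_lt_trans; [exact Hu |]. expand_partial_sum. lra.
Qed.

(** * The mean value theorem *)

(** The intermediate point is interior, unlike in [MVT_gen]; strict monotonicity
    and strict concavity need this, with mere continuity at the two ends because
    [sinc] is differentiated only away from 0. *)
Lemma mean_value (f df : R -> R) (a b : R) :
  a < b ->
  (forall x, a <= x <= b -> continuity_pt f x) ->
  (forall x, a < x < b -> is_derive f x (df x)) ->
  exists c, a < c < b /\ f b - f a = df c * (b - a).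
Proof.
  intros Hab Hc Hd.
  assert (pr : forall c, a < c < b -> derivable_pt f c).
  { intros c Hcc. exists (df c). apply is_derive_Reals. now apply Hd. }
  destruct (MVT f id a b pr (fun c _ => derivable_pt_id c) Hab Hc) as (c & P & E).
  { intros c _. apply derivable_continuous_pt, derivable_pt_id. }
  exists c. split; [exact P |].
  rewrite derive_pt_id, Derive_Reals in E. unfold id in E.
  rewrite (is_derive_unique _ _ _ (Hd c P)) in E. lra.
Qed.

Lemma strictly_decreasing_of_derive (f df : R -> R) (a b : R) :
  a < b ->
  (forall x, a <= x <= b -> continuity_pt f x) ->
  (forall x, a < x < b -> is_derive f x (df x)) ->
  (forall x, a < x < b -> df x < 0) ->
  f b < f a.
Proof.
  intros Hab Hc Hd Hneg.
  destruct (mean_value f df a b Hab Hc Hd) as (c & P & E).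
  specialize (Hneg c P). nra.
Qed.

Lemma continuity_pt_of_derive (f : R -> R) (x l : R) :
  is_derive f x l -> continuity_pt f x.
Proof.
  intros H. apply derivable_continuous_pt. exists l. now apply is_derive_Reals.
Qed.

(** * Strict concavity of the cardinal sine *)

(** The value 1 at 0 makes the function continuous, so that its strict concavity
    covers the limit at 0 as well. *)
Definition sinc (x : R) : R := if Req_EM_T x 0 then 1 else sin x / x.

Definition dsinc (x : R) : R := (x * cos x - sin x) / x ^ 2.

Lemma sinc_0 : sinc 0 = 1.
Proof. unfold sinc. now destruct (Req_EM_T 0 0). Qed.

Lemma sinc_neq0 (x : R) : x <> 0 -> sinc x = sin x / x.
Proof. intros H. unfold sinc. now destruct (Req_EM_T x 0). Qed.

Lemma sinc_PI2 : sinc (PI / 2) = 2 / PI.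
Proof.
  pose proof PI_bounds. rewrite sinc_neq0, sin_PI2 by lra. field. lra.
Qed.

Lemma dsinc_PI2 : dsinc (PI / 2) = - 2 * p2.
Proof.
  pose proof PI_bounds. unfold dsinc, p2. rewrite sin_PI2, cos_PI2. field. lra.
Qed.

Lemma is_derive_sinc (x : R) : 0 < x -> is_derive sinc x (dsinc x).
Proof.
  intros Hx. apply is_derive_ext_loc with (fun y => sin y / y).
  - apply locally_interval with 0 p_infty; simpl; [exact Hx | exact I |].
    intros y Hy _. symmetry. apply sinc_neq0. lra.
  - auto_derive; [lra |]. unfold dsinc. field. lra.
Qed.

Lemma continuity_pt_sinc (x : R) : 0 <= x -> continuity_pt sinc x.
Proof.
  intros [Hx | <-].
  - exact (continuity_pt_of_derive _ _ _ (is_derive_sinc x Hx)).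
  - apply continuity_pt_filterlim'. rewrite sinc_0.
    apply (is_lim_ext_loc (fun y => sin y / y) sinc 0 1).
    + exists (mkposreal 1 Rlt_0_1). intros y _ Hy. symmetry. now apply sinc_neq0.
    + exact is_lim_sinc_0.
Qed.

(** Numerator of the second derivative of [sinc]: it vanishes at 0 and its own
    derivative collapses to [- x ^ 2 * cos x]. *)
Lemma second_derivative_numerator_neg (x : R) :
  0 < x < PI / 2 -> 2 * sin x - 2 * x * cos x - x ^ 2 * sin x < 0.
Proof.
  intros Hx.
  set (h := fun x => 2 * sin x - 2 * x * cos x - x ^ 2 * sin x).
  assert (Hd : forall y, is_derive h y (- (y ^ 2 * cos y))).
  { intros y. unfold h. auto_derive; [exact I | ring]. }
  assert (H : h x < h 0).
  { apply strictly_decreasing_of_derive with (fun y => - (y ^ 2 * cos y)); [lra | | |].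
    - intros y _. exact (continuity_pt_of_derive _ _ _ (Hd y)).
    - intros y _. apply Hd.
    - intros y Hy. assert (0 < cos y) by (apply cos_gt_0; lra).
      assert (0 < y ^ 2 * cos y) by (apply Rmult_lt_0_compat; [apply pow_lt |]; lra). lra. }
  unfold h in H. rewrite sin_0 in H. lra.
Qed.

Lemma is_derive_dsinc (x : R) : 0 < x ->
  is_derive dsinc x ((2 * sin x - 2 * x * cos x - x ^ 2 * sin x) / x ^ 3).
Proof.
  intros Hx. unfold dsinc. auto_derive; [nra |]. field. lra.
Qed.

Lemma continuity_pt_dsinc (x : R) : 0 < x -> continuity_pt dsinc x.
Proof. intros Hx. exact (continuity_pt_of_derive _ _ _ (is_derive_dsinc x Hx)). Qed.

Lemma dsinc_decreasing (x y : R) : 0 < x -> x < y -> y <= PI / 2 -> dsinc y < dsinc x.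
Proof.
  intros Hx Hxy Hy.
  apply strictly_decreasing_of_derive
    with (fun x => (2 * sin x - 2 * x * cos x - x ^ 2 * sin x) / x ^ 3); [exact Hxy | | |].
  - intros z Hz. apply continuity_pt_dsinc. lra.
  - intros z Hz. apply is_derive_dsinc. lra.
  - intros z Hz. apply Rdiv_neg_pos.
    + apply second_derivative_numerator_neg. lra.
    + apply pow_lt. lra.
Qed.

Lemma dsinc_injective (x y : R) :
  0 < x <= PI / 2 -> 0 < y <= PI / 2 -> dsinc x = dsinc y -> x = y.
Proof.
  intros Hx Hy E. destruct (Rtotal_order x y) as [H | [H | H]]; [| exact H |].
  - pose proof (dsinc_decreasing x y). lra.
  - pose proof (dsinc_decreasing y x). lra.
Qed.

Lemma sinc_below_tangent (x y : R) :
  0 < x <= PI / 2 -> 0 <= y <= PI / 2 -> y <> x ->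
  sinc y < sinc x + dsinc x * (y - x).
Proof.
  intros Hx Hy Hne.
  destruct (Rdichotomy y x Hne) as [H | H].
  - destruct (mean_value sinc dsinc y x H) as (c & Hc & E).
    + intros z Hz. apply continuity_pt_sinc. lra.
    + intros z Hz. apply is_derive_sinc. lra.
    + assert (dsinc x < dsinc c) by (apply dsinc_decreasing; lra). nra.
  - destruct (mean_value sinc dsinc x y H) as (c & Hc & E).
    + intros z Hz. apply continuity_pt_sinc. lra.
    + intros z Hz. apply is_derive_sinc. lra.
    + assert (dsinc c < dsinc x) by (apply dsinc_decreasing; lra). nra.
Qed.

(** From [sin x < x] and [1 - cos x = 2 * sin (x / 2) ^ 2]. The bound says that
    [dsinc] tends to 0 at 0, hence takes every value in [(- 2 * p2, 0)]. *)
Lemma dsinc_gt_opp (x : R) : 0 < x < PI / 2 -> - x < dsinc x.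
Proof.
  intros Hx.
  assert (H1 : sin x < x) by (apply sin_lt_x; lra).
  assert (H2 : sin (x / 2) < x / 2) by (apply sin_lt_x; lra).
  assert (H3 : 0 < sin (x / 2)) by (apply sin_gt_0; lra).
  assert (H4 : cos x = 1 - 2 * sin (x / 2) * sin (x / 2)).
  { rewrite <- cos_2a_sin. f_equal. field. }
  unfold dsinc. apply Rmult_lt_reg_r with (x ^ 2); [apply pow_lt; lra |].
  replace ((x * cos x - sin x) / x ^ 2 * x ^ 2) with (x * cos x - sin x) by (field; lra).
  assert (H5 : sin (x / 2) * sin (x / 2) < x / 2 * (x / 2))
    by (apply Rmult_le_0_lt_compat; lra).
  assert (0 < x * (x ^ 2 - 2 * sin (x / 2) * sin (x / 2)))
    by (apply Rmult_lt_0_compat; nra).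
  assert (x * cos x - x > - x * x ^ 2) by (rewrite H4; lra).
  lra.
Qed.

(** * The family extended to the closed interval *)

Definition phi_ext (p x : R) : R := sinc x - 2 / PI - p * (PI - 2 * x).

Lemma phi1_phi_ext (p x : R) : 0 < x -> phi1 p x = phi_ext p x.
Proof. intros Hx. unfold phi1, phi_ext. rewrite sinc_neq0; lra. Qed.

Lemma phi_ext_0 (p : R) : phi_ext p 0 = PI * (p1 - p).
Proof.
  pose proof PI_bounds. unfold phi_ext, p1. rewrite sinc_0. field. lra.
Qed.

Lemma phi_ext_PI2 (p : R) : phi_ext p (PI / 2) = 0.
Proof. unfold phi_ext. rewrite sinc_PI2. lra. Qed.

Lemma phi_ext_below_tangent (p x y : R) :
  0 < x <= PI / 2 -> 0 <= y <= PI / 2 -> y <> x ->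
  phi_ext p y < phi_ext p x + (dsinc x + 2 * p) * (y - x).
Proof.
  intros Hx Hy Hne. pose proof (sinc_below_tangent x y Hx Hy Hne).
  unfold phi_ext. lra.
Qed.

Lemma continuity_pt_phi_ext (p x : R) : 0 <= x -> continuity_pt (phi_ext p) x.
Proof.
  intros Hx. unfold phi_ext.
  apply (continuity_pt_minus (fun x => sinc x - 2 / PI) (fun x => p * (PI - 2 * x))).
  - apply continuity_pt_minus; [now apply continuity_pt_sinc |].
    apply continuity_pt_const. now intros ? ?.
  - reg.
Qed.

(** The tangent at [x] bounds the values at [a] and at [PI / 2] from above;
    averaging the two bounds so that the slope cancels bounds the chord at [x]. *)
Lemma phi_ext_above_chord (p a x : R) :
  0 <= a -> a < x < PI / 2 ->
  phi_ext p a * (PI / 2 - x) < phi_ext p x * (PI / 2 - a).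
Proof.
  intros Ha Hx.
  assert (Ta := phi_ext_below_tangent p x a ltac:(lra) ltac:(lra) ltac:(lra)).
  assert (Tb := phi_ext_below_tangent p x (PI / 2) ltac:(lra) ltac:(lra) ltac:(lra)).
  rewrite phi_ext_PI2 in Tb.
  apply Rmult_lt_compat_r with (r := PI / 2 - x) in Ta; [| lra].
  apply Rmult_lt_compat_r with (r := x - a) in Tb; [| lra].
  lra.
Qed.

Lemma phi_ext_p1_pos (x : R) : 0 < x < PI / 2 -> 0 < phi_ext p1 x.
Proof.
  intros Hx. pose proof (phi_ext_above_chord p1 0 x ltac:(lra) Hx) as H.
  rewrite phi_ext_0 in H. nra.
Qed.

(** The line of slope [- 2 * p2] through the endpoint at [PI / 2] is the tangent
    there. *)
Lemma phi_ext_p2_neg (x : R) : 0 < x < PI / 2 -> phi_ext p2 x < 0.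
Proof.
  intros Hx.
  pose proof (phi_ext_below_tangent p2 (PI / 2) x ltac:(lra) ltac:(lra) ltac:(lra)) as H.
  rewrite phi_ext_PI2, dsinc_PI2 in H. lra.
Qed.

Lemma phi_ext_antitone (p q x : R) :
  0 <= x < PI / 2 -> p < q -> phi_ext q x < phi_ext p x.
Proof. intros Hx Hpq. unfold phi_ext. nra. Qed.

(** * Critical point and zero *)

Lemma p1_bounds : 0.11566 <= p1 < 0.11567.
Proof.
  pose proof PI_bounds.
  replace p1 with (/ PI * (1 - 2 * / PI)) by (unfold p1; field; lra).
  pose proof inv_PI_bounds. nra.
Qed.

Lemma p2_bounds : 0.20264 <= p2 < 0.20265.
Proof.
  pose proof PI_bounds.
  replace p2 with (2 * / PI * / PI) by (unfold p2; field; lra).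
  pose proof inv_PI_bounds. nra.
Qed.

Lemma critical_point_exists (p : R) : p1 < p < p2 ->
  exists x, 0 < x < PI / 2 /\ dsinc x = - 2 * p.
Proof.
  intros Hp. pose proof p1_bounds. pose proof p2_bounds. pose proof PI_bounds.
  assert (Hl : - p < dsinc p) by (apply dsinc_gt_opp; lra).
  (* The left end [p] works because [dsinc p > - p > - 2 * p]. *)
  destruct (IVT_interv (fun x => - 2 * p - dsinc x) p (PI / 2)) as (x & Hx & E).
  - intros x Hx. apply continuity_pt_minus.
    + apply continuity_pt_const. now intros ? ?.
    + apply continuity_pt_dsinc. lra.
  - lra.
  - lra.
  - rewrite dsinc_PI2. lra.
  - exists x. split; [| lra]. split; [lra |].
    destruct (Req_dec x (PI / 2)) as [-> |]; [| lra].
    rewrite dsinc_PI2 in E. lra.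
Qed.

Lemma phi_ext_le_critical (p m x : R) :
  0 < m < PI / 2 -> dsinc m = - 2 * p -> 0 <= x <= PI / 2 ->
  x <> m -> phi_ext p x < phi_ext p m.
Proof.
  intros Hm E Hx Hne.
  pose proof (phi_ext_below_tangent p m x ltac:(lra) ltac:(lra) Hne). nra.
Qed.

Lemma critical_point_is_local_max (p m : R) :
  0 < m < PI / 2 -> dsinc m = - 2 * p -> is_local_max (phi1 p) m.
Proof.
  intros Hm E. apply locally_interval with 0 (PI / 2); simpl; [lra | lra |].
  intros y Hy1 Hy2. rewrite !phi1_phi_ext by lra.
  destruct (Req_dec y m) as [-> | Hne]; [lra |].
  left. apply phi_ext_le_critical; lra.
Qed.

Lemma local_max_is_critical_point (p x : R) :
  0 < x -> is_local_max (phi1 p) x -> dsinc x = - 2 * p.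
Proof.
  intros Hx [eps Hmax].
  assert (Hd : is_derive (phi1 p) x (dsinc x + 2 * p)).
  { unfold phi1. auto_derive; [lra |]. unfold dsinc. field.
    pose proof PI_bounds. lra. }
  assert (pr : derivable_pt (phi1 p) x).
  { exists (dsinc x + 2 * p). now apply is_derive_Reals. }
  pose proof (cond_pos eps).
  pose proof (deriv_maximum (phi1 p) (x - eps) (x + eps) x pr) as H0.
  rewrite Derive_Reals, (is_derive_unique _ _ _ Hd) in H0.
  enough (dsinc x + 2 * p = 0) by lra.
  apply H0; [lra | lra |].
  intros y Hy1 Hy2. apply Hmax. apply Rabs_def1; simpl; unfold minus, plus, opp; simpl; lra.
Qed.

(** The zero is found between 0, where the function is negative, and its
    maximizer, where it exceeds the value 0 taken at [PI / 2]. *)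
Lemma phi_ext_zero_exists (p : R) : p1 < p < p2 ->
  exists x0, 0 < x0 < PI / 2 /\ phi_ext p x0 = 0 /\
    (forall x, 0 < x < x0 -> phi_ext p x < 0) /\
    (forall x, x0 < x < PI / 2 -> 0 < phi_ext p x).
Proof.
  intros Hp. pose proof PI_bounds.
  destruct (critical_point_exists p Hp) as (m & Hm & Em).
  assert (Hpos : 0 < phi_ext p m).
  { rewrite <- (phi_ext_PI2 p). apply phi_ext_le_critical; lra. }
  assert (Hneg : phi_ext p 0 < 0) by (rewrite phi_ext_0; nra).
  destruct (IVT_interv (phi_ext p) 0 m) as (x0 & Hx0 & E0); try lra.
  { intros x Hx. apply continuity_pt_phi_ext. lra. }
  assert (x0 <> 0) by (intros ->; lra).
  exists x0. repeat split; try lra.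
  - intros x Hx.
    pose proof (phi_ext_above_chord p x x0 ltac:(lra) ltac:(lra)) as Hc.
    rewrite E0 in Hc. nra.
  - intros x Hx.
    pose proof (phi_ext_above_chord p x0 x ltac:(lra) Hx) as Hc.
    rewrite E0 in Hc. nra.
Qed.

(** * Error at the left endpoint *)

Lemma phi1_right_limit (p : R) : is_right_limit (phi1 p) 0 (PI * (p1 - p)).
Proof.
  unfold is_right_limit. rewrite <- phi_ext_0.
  apply filterlim_ext_loc with (phi_ext p).
  - exists (mkposreal 1 Rlt_0_1). intros y _ Hy. symmetry. now apply phi1_phi_ext.
  - eapply filterlim_filter_le_1.
    + apply filter_le_within.
    + apply (continuity_pt_filterlim (phi_ext p) 0).
      apply continuity_pt_phi_ext. lra.
Qed.

Lemma phi1_right_limit_unique (p l : R) :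
  is_right_limit (phi1 p) 0 l -> l = PI * (p1 - p).
Proof.
  intros Hl. eapply (filterlim_locally_unique (F := at_right 0) (phi1 p)).
  - exact Hl.
  - apply phi1_right_limit.
Qed.

(** * The balance equation *)

(** The parameter [p] equalizes the two extreme errors: the value at the
    critical point [m], and the modulus of the limit at 0. *)
Definition balanced (p m : R) : Prop :=
  p1 < p /\ 0 < m < PI / 2 /\ dsinc m = - 2 * p /\ phi_ext p m = PI * (p - p1).

(** With the parameter written as [- dsinc x / 2], so that [x] is the critical
    point, this is the critical value minus the modulus of the limit at 0. Its
    derivative is the second derivative of [sinc] times [PI - x], since the two
    terms in [dsinc x] cancel; it is bounded away from 0 near the root, so values
    as small as 0.00000005 at the points used below still have a provable sign. *)
Definition balance (x : R) : R := sinc x + 1 - 4 / PI + dsinc x * (PI - x).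

Lemma balance_spec (p x : R) :
  dsinc x = - 2 * p -> balance x = phi_ext p x - PI * (p - p1).
Proof.
  intros E. pose proof PI_bounds. unfold balance, phi_ext, p1. rewrite E. field. lra.
Qed.

Lemma continuity_pt_balance (x : R) : 0 < x -> continuity_pt balance x.
Proof.
  intros Hx. unfold balance.
  apply (continuity_pt_plus (fun x => sinc x + 1 - 4 / PI) (fun x => dsinc x * (PI - x))).
  - apply (continuity_pt_minus (fun x => sinc x + 1) (fun _ => 4 / PI)).
    + apply continuity_pt_plus; [apply continuity_pt_sinc; lra |].
      apply continuity_pt_const. now intros ? ?.
    + apply continuity_pt_const. now intros ? ?.
  - apply (continuity_pt_mult dsinc (fun x => PI - x)); [now apply continuity_pt_dsinc |].
    reg.
Qed.

(** The last conjunct bounds the error [PI * (p - p1) = PI * p - 1 + 2 / PI] for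
    the parameter [p = - dsinc x / 2]. *)
Lemma balance_left_end :
  0 < balance 0.86172 /\ dsinc 0.86172 < - 0.266468 /\
  0.0551875 < PI * (- dsinc 0.86172 / 2 - p1).
Proof.
  pose proof PI_bounds as HP. pose proof inv_PI_bounds.
  pose proof sin_86172_bounds. pose proof cos_86172_bounds.
  assert (Hs : dsinc 0.86172 = (0.86172 * cos 0.86172 - sin 0.86172) * / (0.86172 ^ 2))
    by reflexivity.
  set (d := dsinc 0.86172) in *.
  assert (Hd : - 0.2664686094 < d < - 0.2664686093) by (rewrite Hs; lra).
  assert (PI * (- d / 2 - p1) = PI * - d / 2 - 1 + 2 * / PI)
    by (unfold p1; field; lra).
  (* These products make the remaining inequalities linear in [PI * d]. *)
  assert (0 < (PI - 3.1415926534) * (- d)) by nra.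
  assert (0 < (3.1415926536 - PI) * (- d)) by nra.
  repeat split.
  - unfold balance. fold d. rewrite sinc_neq0 by lra. unfold Rdiv. lra.
  - lra.
  - lra.
Qed.

(** The rational point lies only about 0.0000001 above the root: at the root the
    error is 0.05518789, close to the upper bound 0.055188 that is to be proved. *)
Lemma balance_right_end :
  balance 0.8617206 < 0 /\ - 0.266470 < dsinc 0.8617206 /\
  PI * (- dsinc 0.8617206 / 2 - p1) < 0.055188.
Proof.
  pose proof PI_bounds as HP. pose proof inv_PI_bounds.
  pose proof sin_8617206_bounds. pose proof cos_8617206_bounds.
  assert (Hs : dsinc 0.8617206 =
    (0.8617206 * cos 0.8617206 - sin 0.8617206) * / (0.8617206 ^ 2)) by reflexivity.
  set (d := dsinc 0.8617206) in *.
  assert (Hd : - 0.2664687668 < d < - 0.2664687667) by (rewrite Hs; lra).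
  assert (PI * (- d / 2 - p1) = PI * - d / 2 - 1 + 2 * / PI)
    by (unfold p1; field; lra).
  assert (0 < (PI - 3.1415926534) * (- d)) by nra.
  assert (0 < (3.1415926536 - PI) * (- d)) by nra.
  repeat split.
  - unfold balance. fold d. rewrite sinc_neq0 by lra. unfold Rdiv. lra.
  - lra.
  - lra.
Qed.

Lemma balanced_parameter_exists :
  exists p0 m0, balanced p0 m0 /\
    0.13323 <= p0 < 0.13324 /\ 0.055187 <= PI * (p0 - p1) < 0.055188.
Proof.
  pose proof PI_bounds.
  destruct balance_left_end as (Bl & Dl & El).
  destruct balance_right_end as (Br & Dr & Er).
  destruct (IVT_interv (fun x => - balance x) 0.86172 0.8617206) as (m0 & Hm & E); try lra.
  { intros x Hx. apply continuity_pt_opp, continuity_pt_balance. lra. }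
  assert (m0 <> 0.86172) by (intros ->; lra).
  assert (m0 <> 0.8617206) by (intros ->; lra).
  pose proof (dsinc_decreasing 0.86172 m0 ltac:(lra) ltac:(lra) ltac:(lra)).
  pose proof (dsinc_decreasing m0 0.8617206 ltac:(lra) ltac:(lra) ltac:(lra)).
  exists (- dsinc m0 / 2), m0.
  assert (Hc : dsinc m0 = - 2 * (- dsinc m0 / 2)) by lra.
  pose proof (balance_spec _ _ Hc).
  repeat split; try lra; nra.
Qed.

(** * Optimality *)

Lemma sup_abs_eq (f : R -> R) (a b d x : R) :
  a < x < b -> Rabs (f x) = d -> (forall y, a < y < b -> Rabs (f y) <= d) ->
  sup_abs f a b = Finite d.
Proof.
  intros Hx Ex Hle. apply is_lub_Rbar_unique. split.
  - intros y (z & Hz & ->). simpl. now apply Hle.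
  - intros u Hu. apply Hu. now exists x.
Qed.

Lemma le_sup_abs (f : R -> R) (a b s x : R) :
  sup_abs f a b = Finite s -> a < x < b -> Rabs (f x) <= s.
Proof.
  intros E Hx. destruct (Lub_Rbar_correct (fun y => exists x, a < x < b /\ y = Rabs (f x)))
    as [Hub _].
  unfold sup_abs in E. rewrite E in Hub.
  exact (Hub (Rabs (f x)) (ex_intro _ x (conj Hx eq_refl))).
Qed.


(** Both extreme errors equal [PI * (p0 - p1)]: the concave function [phi_ext p0]
    is bounded above by its critical value, and below by the smaller of its
    end values [- (PI * (p0 - p1))] and 0. *)
Lemma sup_abs_balanced (p0 m0 : R) : balanced p0 m0 ->
  sup_abs (phi1 p0) 0 (PI / 2) = Finite (PI * (p0 - p1)).
Proof.
  intros (Hp & Hm0 & E0 & B0). pose proof PI_bounds.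
  assert (0 < PI * (p0 - p1)) by nra.
  apply sup_abs_eq with m0; [exact Hm0 | |].
  - rewrite phi1_phi_ext, B0 by lra. apply Rabs_pos_eq. lra.
  - intros y Hy. rewrite phi1_phi_ext by lra. apply Rabs_le. split.
    + pose proof (phi_ext_above_chord p0 0 y ltac:(lra) Hy) as Hc.
      rewrite phi_ext_0 in Hc. nra.
    + rewrite <- B0. destruct (Req_dec y m0) as [-> | Hne]; [lra |].
      left. apply phi_ext_le_critical; lra.
Qed.

(** Lowering the parameter raises the value at [m0]; raising it increases the
    error near 0. *)
Lemma exceeds_balanced (p0 m0 p : R) : balanced p0 m0 -> p <> p0 ->
  exists x, 0 < x < PI / 2 /\ PI * (p0 - p1) < Rabs (phi1 p x).
Proof.
  intros (Hp & Hm0 & E0 & B0) Hne. pose proof PI_bounds.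
  destruct (Rdichotomy p p0 Hne) as [H0 | H0].
  - exists m0. split; [exact Hm0 |].
    rewrite phi1_phi_ext, <- B0 by lra.
    eapply Rlt_le_trans; [| apply Rle_abs]. apply phi_ext_antitone; lra.
  - assert (Hlim : at_right 0 (fun x => phi1 p x < - (PI * (p0 - p1)))).
    { apply (phi1_right_limit p (fun y => y < - (PI * (p0 - p1)))).
      apply open_lt. nra. }
    assert (Hnear : at_right 0 (fun x => 0 < x < PI / 2)).
    { assert (Hpos : 0 < PI / 2) by lra.
      exists (mkposreal _ Hpos). intros y Hy H0y. split; [exact H0y |].
      apply Rabs_def2 in Hy. unfold minus, plus, opp in Hy; simpl in Hy. lra. }
    destruct (filter_ex _ (filter_and _ _ Hlim Hnear)) as (x & Hx1 & Hx2).
    exists x. split; [exact Hx2 |].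
    rewrite <- Rabs_Ropp. eapply Rlt_le_trans; [| apply Rle_abs]. lra.
Qed.

Lemma minimax_error_balanced (p0 m0 : R) : balanced p0 m0 ->
  minimax_error phi1 0 (PI / 2) = Finite (PI * (p0 - p1)).
Proof.
  intros HB. pose proof p1_bounds. pose proof (proj1 HB). apply is_glb_Rbar_unique. split.
  - intros s (p & _ & Es). simpl.
    destruct (Req_dec p p0) as [-> | Hne].
    + rewrite (sup_abs_balanced p0 m0 HB) in Es. injection Es. lra.
    + destruct (exceeds_balanced p0 m0 p HB Hne) as (x & Hx & Hlt).
      pose proof (le_sup_abs _ _ _ _ _ Es Hx). lra.
  - intros l Hl. apply Hl. exists p0. split; [lra |]. now apply sup_abs_balanced with m0.
Qed.

Lemma minimax_parameter_balanced (p0 m0 p : R) : balanced p0 m0 ->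
  is_minimax_parameter phi1 0 (PI / 2) p <-> p = p0.
Proof.
  intros HB. pose proof p1_bounds. pose proof (proj1 HB). unfold is_minimax_parameter.
  rewrite (minimax_error_balanced p0 m0 HB). split.
  - intros [_ Es]. destruct (Req_dec p p0) as [| Hne]; [assumption |].
    destruct (exceeds_balanced p0 m0 p HB Hne) as (x & Hx & Hlt).
    pose proof (le_sup_abs _ _ _ _ _ Es Hx). lra.
  - intros ->. split; [lra |]. now apply sup_abs_balanced with m0.
Qed.

(** As the parameter grows, the critical value decreases strictly and the
    modulus of the limit at 0 increases strictly. *)
Lemma balanced_parameter_unique (p0 m0 p m : R) :
  balanced p0 m0 -> balanced p m -> p = p0.
Proof.
  intros (Hp0 & Hm0 & E0 & B0) (Hp & Hm & Em & E). pose proof PI_bounds.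
  destruct (Rtotal_order p p0) as [H0 | [H0 | H0]]; [exfalso | exact H0 | exfalso].
  - pose proof (phi_ext_antitone p p0 m0 ltac:(lra) H0).
    assert (phi_ext p m0 <= phi_ext p m).
    { destruct (Req_dec m0 m) as [-> |]; [lra |]. left. apply phi_ext_le_critical; lra. }
    nra.
  - pose proof (phi_ext_antitone p0 p m ltac:(lra) H0).
    assert (phi_ext p0 m <= phi_ext p0 m0).
    { destruct (Req_dec m m0) as [-> |]; [lra |]. left. apply phi_ext_le_critical; lra. }
    nra.
Qed.

Theorem mainTheorem4 :
  (0.11566 <= p1 < 0.11567 /\ 0.20264 <= p2 < 0.20265) /\
  (* (i) *)
  (forall p, 0 < p <= p1 -> forall x, 0 < x < PI / 2 ->
     sin x / x > 2 / PI + p1 * (PI - 2 * x) /\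
     2 / PI + p1 * (PI - 2 * x) >= 2 / PI + p * (PI - 2 * x)) /\
  (* (ii) *)
  (forall p, p1 < p < p2 ->
     exists x0, 0 < x0 < PI / 2 /\
       phi1 p x0 = 0 /\
       (forall x, 0 < x < PI / 2 -> phi1 p x = 0 -> x = x0) /\
       (forall x, 0 < x < x0 -> sin x / x < 2 / PI + p * (PI - 2 * x)) /\
       (forall x, x0 < x < PI / 2 -> sin x / x > 2 / PI + p * (PI - 2 * x))) /\
  (* (iii) *)
  (forall p, p2 <= p -> forall x, 0 < x < PI / 2 ->
     sin x / x < 2 / PI + p2 * (PI - 2 * x) /\
     2 / PI + p2 * (PI - 2 * x) <= 2 / PI + p * (PI - 2 * x)) /\
  exists m : R -> R,
    (* (iv) *)
    (forall p, p1 < p < p2 ->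
       0 < m p < PI / 2 /\
       is_local_max (phi1 p) (m p) /\
       (forall x, 0 < x < PI / 2 -> is_local_max (phi1 p) x -> x = m p)) /\
    (* (v) *)
    exists p0 d0 : R,
      p1 < p0 < p2 /\
      (forall p, p1 < p < p2 ->
         ((exists l, is_right_limit (phi1 p) 0 l /\
                     Rabs l = Rabs (phi1 p (m p))) <-> p = p0)) /\
      0.13323 <= p0 < 0.13324 /\
      (exists l, is_right_limit (phi1 p0) 0 l /\ d0 = Rabs l) /\
      d0 = Rabs (phi1 p0 (m p0)) /\
      0.055187 <= d0 < 0.055188 /\
      Finite d0 = minimax_error phi1 0 (PI / 2) /\
      (forall p, is_minimax_parameter phi1 0 (PI / 2) p <-> p = p0).
Proof.
  pose proof PI_bounds. pose proof p1_bounds. pose proof p2_bounds.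
  split; [now split |].
  split.
  { intros p Hp x Hx. pose proof (phi_ext_p1_pos x Hx) as Hpos.
    rewrite <- phi1_phi_ext in Hpos by lra. unfold phi1 in Hpos. split; nra. }
  split.
  { intros p Hp. destruct (phi_ext_zero_exists p Hp) as (x0 & Hx0 & E0 & Hneg & Hpos).
    exists x0. split; [exact Hx0 |]. split; [rewrite phi1_phi_ext; lra |].
    split; [| split].
    - intros x Hx E. rewrite phi1_phi_ext in E by lra.
      destruct (Rtotal_order x x0) as [H' | [H' | H']]; [| exact H' |].
      + specialize (Hneg x). lra.
      + specialize (Hpos x). lra.
    - intros x Hx. specialize (Hneg x Hx).
      rewrite <- phi1_phi_ext in Hneg by lra. unfold phi1 in Hneg. lra.
    - intros x Hx. specialize (Hpos x Hx).
      rewrite <- phi1_phi_ext in Hpos by lra. unfold phi1 in Hpos. lra. }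
  split.
  { intros p Hp x Hx. pose proof (phi_ext_p2_neg x Hx) as Hneg.
    rewrite <- phi1_phi_ext in Hneg by lra. unfold phi1 in Hneg. split; nra. }
  destruct (choice (fun p x => p1 < p < p2 -> 0 < x < PI / 2 /\ dsinc x = - 2 * p))
    as [m Hm].
  { intros p. destruct (Rlt_dec p1 p) as [Hl |]; [| exists 0; lra].
    destruct (Rlt_dec p p2) as [Hr |]; [| exists 0; lra].
    destruct (critical_point_exists p (conj Hl Hr)) as [x Hx]. now exists x. }
  exists m. split.
  { intros p Hp. destruct (Hm p Hp) as [Hr E]. split; [exact Hr |]. split.
    - now apply critical_point_is_local_max.
    - intros x Hx Hmax. apply local_max_is_critical_point in Hmax; [| lra].
      apply dsinc_injective; lra. }
  destruct balanced_parameter_exists as (p0 & m0 & HB & Hp0 & Hd0).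
  destruct (HB) as (Hpl & Hm0 & E0 & B0).
  assert (Hr0 : p1 < p0 < p2) by lra.
  assert (Emp0 : m p0 = m0).
  { destruct (Hm p0 Hr0). apply dsinc_injective; lra. }
  assert (Hlim : forall p, p1 < p -> Rabs (PI * (p1 - p)) = PI * (p - p1)).
  { intros p Hp. rewrite Rabs_left by nra. ring. }
  assert (Hpeak : forall p, p1 < p < p2 -> Rabs (phi1 p (m p)) = phi_ext p (m p)).
  { intros p Hp. destruct (Hm p Hp) as [Hr E]. rewrite phi1_phi_ext by lra.
    apply Rabs_pos_eq. rewrite <- (phi_ext_PI2 p). left.
    apply phi_ext_le_critical; lra. }
  exists p0, (PI * (p0 - p1)).
  split; [exact Hr0 |].
  split.
  { intros p Hp. destruct (Hm p Hp) as [Hr E]. split.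
    - intros (l & Hl & El). apply phi1_right_limit_unique in Hl. subst l.
      rewrite Hlim, Hpeak in El by lra.
      apply balanced_parameter_unique with m0 (m p); [exact HB |].
      now repeat split.
    - intros ->. exists (PI * (p1 - p0)). split; [apply phi1_right_limit |].
      rewrite Hlim, Hpeak, Emp0 by lra. now symmetry. }
  split; [exact Hp0 |].
  split.
  { exists (PI * (p1 - p0)). split; [apply phi1_right_limit |].
    rewrite Hlim; lra. }
  split; [rewrite Hpeak, Emp0 by lra; now symmetry |].
  split; [exact Hd0 |].
  split; [symmetry; apply minimax_error_balanced with m0; exact HB |].
  intros p. apply minimax_parameter_balanced with m0; exact HB.
Qed.
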